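(* Let $A$ be a nilpotent commutative associative real algebra of dimension $n$ with an inner product $\langle\cdot,\cdot\rangle$, and consider on the Lie algebra $\mathfrak{aff}(A)$ the Hermitian structure $(J,F)$, where $J$ is the standard abelian complex structure and $F$ is the fundamental form of $J$ and the inner product $\langle\cdot,\cdot\rangle\oplus\langle\cdot,\cdot\rangle$. Then $(J,F)$ is balanced if and only if there exists an orthonormal basis $\{e_1,\dots,e_n\}$ of $A$ such that $\sum_{i=1}^n e_i^2=0$.
   Context: For a finite-dimensional commutative associative algebra $A$, $\mathfrak{aff}(A)=A\oplus A$ is the Lie algebra with bracket $[(a,b),(a',b')]=(0,ab'-ba')$. The standard abelian complex structure is $J(a,b)=(b,-a)$; it satisfies $J^2=-\mathrm{Id}$, it is integrable, and $[JX,JY]=[X,Y]$. The inner product $\langle\cdot,\cdot\rangle\oplus\langle\cdot,\cdot\rangle$ on $\mathfrak{aff}(A)$ (two summands orthogonal), again denoted $\langle\cdot,\cdot\rangle$, is $J$-Hermitian, and $F(X,Y)=\langle X,JY\rangle$. Since $\dim\mathfrak{aff}(A)=2n$, $(J,F)$ is balanced means $d(F^{n-1})=0$, with $d$ the Chevalley-Eilenberg differential ($d\alpha(X,Y)=-\alpha([X,Y])$ on $1$-forms). *)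

(* Defs.v *)
From HB Require Import structures.
From mathcomp Require Import all_boot all_order all_fingroup all_algebra.
From mathcomp Require Import reals.

Set Implicit Arguments.
Unset Strict Implicit.
Unset Printing Implicit Defensive.

Import Order.TTheory GRing.Theory Num.Theory.
Local Open Scope ring_scope.

Section ExteriorForms.
Variables (R : realType) (V : vectType R).

(* The operations below are the usual ones on alternating multilinear forms.
   Their formulas make sense for every function of k vectors, and they preserve
   alternating multilinear forms, so that property is not bundled. *)
Definition kform (k : nat) := ('I_k -> V) -> R.

(* Normalised so that, for 1-forms,
   (a /\ b) (X, Y) = a X * b Y - a Y * b X. *)
Definition wedge p q (a : kform p) (b : kform q) : kform (p + q) :=
  fun x => (p`! * q`!)%:R^-1 *
    \sum_(s : 'S_(p + q)) (-1) ^+ s *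
       (a (fun i => x (s (lshift q i))) * b (fun j => x (s (rshift p j)))).

Fixpoint wedge_pow (p : nat) (a : kform p) (k : nat) : kform (k * p) :=
  if k is k'.+1 then wedge a (@wedge_pow p a k') else fun=> 1.
Arguments wedge_pow {p} a k.

Definition vcons m (v : V) (x : 'I_m -> V) : 'I_m.+1 -> V :=
  fun l => if unlift ord0 l is Some l' then x l' else v.

(* The Chevalley-Eilenberg differential for the Lie bracket br:
   (d a)(x_0, ..., x_k) is the sum over i < j of
   (-1) ^ (i + j) a([x_i, x_j], x_0, .., ^x_i, .., ^x_j, .., x_k).
   When i < j, the index lift j i has value i, and lift j \o lift i enumerates
   increasingly the indices other than i and j. *)
Definition ce_diff (br : V -> V -> V) k : kform k -> kform k.+1 :=
  match k with
  | 0 => fun _ _ => 0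
  | m.+1 => fun a x =>
      \sum_(j < m.+2) \sum_(i < m.+1 | (i < j)%N)
        (-1) ^+ (i + j) *
        a (vcons (br (x (lift j i)) (x j)) (fun l => x (lift j (lift i l))))
  end.

Definition fundamental_form (J : V -> V) (g : {dot V for idfun}) : kform 2 :=
  fun x => g (x ord0) (J (x ord_max)).

Definition balanced (br : V -> V -> V) (J : V -> V) (g : {dot V for idfun}) :=
  let m := (\dim {:V})./2 in
  forall x, ce_diff br (wedge_pow (fundamental_form J g) m.-1) x = 0.

End ExteriorForms.

Section Aff.
Variables (R : realType) (A : vectType R).

(* MathComp algebras are unital, hence never nilpotent unless trivial: the
   algebra is given by its bilinear product. The condition says that all
   products of k + 1 elements vanish. *)
Definition nilpotent_mul (mul : A -> A -> A) :=
  exists k, forall (x : A) (s : k.-tuple A), foldl mul x s = 0.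

Definition aff_bracket (mul : A -> A -> A) (X Y : A * A) : A * A :=
  (0, mul X.1 Y.2 - mul X.2 Y.1).

Definition aff_J (X : A * A) : A * A := (X.2, - X.1).

Definition dot_sum (g : {dot A for idfun}) (X Y : A * A) : R :=
  g X.1 Y.1 + g X.2 Y.2.

Section DotSum.
Variable g : {dot A for idfun}.

Fact dot_sum_bilinear :
  bilinear_for (GRing.Scale.Law.clone _ _ *%R _)
               (GRing.Scale.Law.clone _ _ (idfun \; *%R) _) (dot_sum g).
Proof.
split=> u a x y; rewrite /dot_sum /=.
  by rewrite !linearPl /= mulrDr addrACA.
by rewrite !linearPr /= mulrDr addrACA.
Qed.

Fact dot_sum_sym X Y : dot_sum g X Y = (-1) ^+ false * idfun (dot_sum g Y X).
Proof.
by rewrite expr0 mul1r /dot_sum /= [g X.1 _]hermC [g X.2 _]hermC !expr0 !mul1r.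
Qed.

Fact dot_sum_gt0 X : X != 0 -> 0 < dot_sum g X X.
Proof.
have ge0 u : 0 <= g u u.
  by have [->|/neq0_dnorm_gt0/ltW//] := eqVneq u 0; rewrite linear0r.
case: X => a b; rewrite /dot_sum -pair_eqE /= negb_and.
case/orP=> /neq0_dnorm_gt0 h; first exact: ltr_wpDr.
exact: ltr_wpDl.
Qed.

HB.instance Definition _ :=
  @bilinear_isBilinear.Build R _ _ R _ _ (dot_sum g) dot_sum_bilinear.
HB.instance Definition _ :=
  @isHermitianSesquilinear.Build R _ false idfun (dot_sum g) dot_sum_sym.
HB.instance Definition _ :=
  @isDotProduct.Build R _ (dot_sum g) dot_sum_gt0.

End DotSum.
End Aff.

(* Main.v *)
From HB Require Import structures.
Require Import Defs.
From mathcomp Require Import all_boot all_order all_fingroup all_algebra.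
From mathcomp Require Import reals zify.

Set Implicit Arguments.
Unset Strict Implicit.
Unset Printing Implicit Defensive.

Import Order.TTheory GRing.Theory Num.Theory.
Local Open Scope ring_scope.

(** Fix an orthonormal basis (e_i) of A and put u_i = (e_i, 0), v_i = (0, e_i),
    an orthonormal basis of aff(A) with F = \sum_i u^i /\ v^i on the dual basis.
    Write vol for the determinant of the coordinates of 2n vectors, n = dim A.
    Everything follows from one formula: for some c > 0,

      d(F^(n-1)) (x) = - c vol ((0, \sum_i e_i^2), x).

    As vol is nondegenerate, the left side vanishes identically if and only if
    \sum_i e_i^2 = 0.  For the direct implication this is applied to any
    orthonormal basis of A, for the converse to the given one.

    The formula comes in two halves.  The algebraic half (wedge_pow_vol) is

      F^(n-1) (x) = c \sum_k vol (u_k, v_k, x).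

    Expanding the wedge products, F^k is a positive multiple of the sum, over
    all sequences a of k indices, of the determinants pairing the arguments with
    u^(a_1), v^(a_1), ..., u^(a_k), v^(a_k); the expansion rests on a Laplace
    formula summed over all permutations (sum_sign_det_block).  For k = n - 1
    only the injective a contribute; each misses exactly one index b, and its
    determinant is vol (u_b, v_b, x), because moving indices around permutes the
    covectors two by two, hence evenly (odd_double_perm).

    The differential half (ce_diff_vol) is

      d (vol (u, v, -)) (x) = - vol ([u, v], x)

    for any antisymmetric bracket whose operators ad X are traceless.  It uses
    only that the derivation induced by ad X multiplies vol by the trace of
    ad X, so that it kills vol (vol_bracket_sum).  In aff(A) the operators ad X
    are nilpotent because A is, hence traceless (mxtrace_nilpotent), and
    [u_k, v_k] = (0, e_k^2).

    For n <= 1 the power of F is the constant 1, so the structure is balanced; the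
    sum of squares also vanishes, by nilpotency when n = 1. *)

(** * Two facts on matrices *)

(** If M ^+ k = 0 then X - M divides X ^+ k over R[X], so the characteristic
    polynomial divides a power of X and is X ^+ (n + 1). *)
Lemma mxtrace_nilpotent (R : fieldType) n (M : 'M[R]_n.+1) k :
  M ^+ k = 0 -> \tr M = 0.
Proof.
move=> Mk0; pose P := map_mx (@polyC R) M.
have cXP : GRing.comm ('X%:M : 'M_n.+1) P by rewrite /GRing.comm -!mulmxE scalar_mxC.
have := subrXX_comm k cXP.
have -> : P ^+ k = 0 by rewrite /P -rmorphXn /= Mk0 map_mx0.
rewrite subr0 => /(congr1 determinant); rewrite det_mulmx => eq_det.
have : char_poly M %| ('X - 0%:P) ^+ (k * n.+1).
  rewrite subr0 exprM -det_scalar rmorphXn /= eq_det.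
  exact: dvdp_mulIl.
case/dvdp_exp_XsubCP => i _; rewrite subr0 => eqpX.
have ni : i = n.+1.
  by have := eqp_size eqpX; rewrite size_char_poly size_polyXn => -[].
have /eqP charM : char_poly M == 'X^(n.+1).
  by rewrite -eqp_monic ?char_poly_monic ?monicXn //; rewrite ni in eqpX.
have := char_poly_trace M isT.
by rewrite charM coefXn /= ltn_eqF // => /esym/eqP; rewrite oppr_eq0 => /eqP.
Qed.

(** Expanding both minors over a permutation t that preserves the two blocks of
    columns and replacing s by t * s turns each summand into a term of the
    Leibniz formula for \det P; C counts these t. *)
Lemma sum_sign_det_block (R : comNzRingType) p q :
  {C : nat | (0 < C)%N &
   forall P : 'M[R]_(p + q),
     \sum_(s : 'S_(p + q)) (-1) ^+ s *
       (\det (ulsubmx (row_perm s P)) * \det (drsubmx (row_perm s P)))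
     = C%:R * \det P}.
Proof.
pose inblock (t : 'S_(p + q)) := [forall i, (t i < p)%N == (i < p)%N].
exists (\sum_t inblock t)%N.
  have in1 : inblock 1%g by apply/forallP=> i; rewrite perm1.
  by rewrite (bigD1 1%g) //= in1.
move=> P.
(* The product of the two minors is the determinant of the row-permuted P with
   its off-diagonal blocks replaced by 0, which is what mask does. *)
pose mask (i j : 'I_(p + q)) : R := ((j < p)%N == (i < p)%N)%:R.
have blockE s : \det (ulsubmx (row_perm s P)) * \det (drsubmx (row_perm s P))
    = \sum_(t : 'S_(p + q)) (-1) ^+ t * \prod_i (P (s i) (t i) * mask i (t i)).
  rewrite -(det_lblock _ 0); apply: eq_bigr => t _; congr (_ * _).
  apply: eq_bigr => i _; rewrite !mxE /mask.
  case: (split_ordP i) => i' ->; rewrite !mxE;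
    case: (split_ordP (t _)) => j' ->;
    rewrite !mxE /= ?ltn_ord ?ltnNge ?leq_addr /=;
    by rewrite ?mulr1 ?mulr0.
rewrite (eq_bigr _ (fun s _ => congr1 (GRing.mul _) (blockE s))).
under eq_bigr => s _ do rewrite big_distrr /=.
rewrite exchange_big /=.
have maskE (t : 'S_(p + q)) : \prod_i mask i (t i) = (inblock t)%:R.
  have [/forallP h|] := boolP (inblock t).
    by rewrite big1 // => i _; rewrite /mask (eqP (h i)) eqxx.
  by rewrite negb_forall => /existsP[i /negbTE h]; rewrite (bigD1 i) //= /mask h mul0r.
transitivity (\sum_(t : 'S_(p + q)) (inblock t)%:R * \det P); last first.
  by rewrite -mulr_suml -natr_sum.
apply: eq_bigr => t _.
rewrite (reindex_inj (mulgI t)) /= -maskE -det_tr big_distrr /=.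
apply: eq_bigr => s _; rewrite odd_permM signr_addb.
rewrite mulrA [_ * _ * (-1) ^+ t]mulrAC -expr2 sqrr_sign mul1r.
rewrite mulrCA; congr (_ * _); rewrite big_split mulrC /=; congr (_ * _).
rewrite [RHS](reindex_inj (@perm_inj _ t)) /=.
by apply: eq_bigr => i _; rewrite mxE permM.
Qed.

(** * Determinants of coordinates *)

Section Volume.
Variables (R : realType) (V : vectType R).

Lemma vcons0 m (v : V) (x : 'I_m -> V) : vcons v x ord0 = v.
Proof. by rewrite /vcons unlift_none. Qed.

Lemma vcons_lift0 m (v : V) (x : 'I_m -> V) i : vcons v x (lift ord0 i) = x i.
Proof. by rewrite /vcons liftK. Qed.

Lemma vcons_lift m (v : V) (x : 'I_m.+1 -> V) i l :
  vcons v x (lift (lift ord0 i) l) = vcons v (fun l' => x (lift i l')) l.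
Proof.
case: (unliftP ord0 l) => [l'|] ->; last first.
  rewrite vcons0; have -> : lift (lift ord0 i) ord0 = ord0 by apply: val_inj.
  exact: vcons0.
rewrite vcons_lift0.
have -> : lift (lift ord0 i) (lift ord0 l') = lift ord0 (lift i l').
  apply: val_inj; rewrite /= /bump /=; lia.
exact: vcons_lift0.
Qed.

Lemma eq_vcons m (v : V) (x y : 'I_m -> V) : x =1 y -> vcons v x =1 vcons v y.
Proof. by move=> xy i; rewrite /vcons; case: unlift. Qed.

Variables (N : nat) (phi : {linear V -> 'rV[R]_N.+1}).

Definition coords (f : 'I_N.+1 -> V) : 'M[R]_N.+1 := \matrix_(i < N.+1) phi (f i).
Definition vol (f : 'I_N.+1 -> V) : R := \det (coords f).

Lemma eq_vol f h : f =1 h -> vol f = vol h.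
Proof.
by move=> fh; congr (\det _); apply/row_matrixP => i; rewrite !rowK fh.
Qed.

(** The minors of the matrix on the left, expanded along its first row, are those
    of coords f without row i: this is the cofactor expansion of the determinant
    of f with f i replaced by y. *)
Lemma vol_vcons_lift y (f : 'I_N.+1 -> V) i :
  vol (vcons y (fun l => f (lift i l))) =
  (-1) ^+ i * (phi y *m \adj (coords f)) 0 i.
Proof.
rewrite /vol (expand_det_row _ ord0) mxE big_distrr /=; apply: eq_bigr => j _.
rewrite !mxE vcons0 [RHS]mulrCA; congr (_ * _).
rewrite /cofactor /= add0n exprD !mulrA -expr2 sqrr_sign mul1r.
congr (_ * \det _); apply/matrixP => k l.
by rewrite !mxE vcons_lift0.
Qed.

Lemma vol_vcons y (x : 'I_N -> V) :
  vol (vcons y x) = (phi y *m \adj (coords (vcons 0 x))) 0 0.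
Proof.
have := vol_vcons_lift y (vcons 0 x) ord0; rewrite expr0 mul1r => <-.
by apply/eq_vol/eq_vcons => l; rewrite vcons_lift0.
Qed.

Lemma vol_sum I (r : seq I) (P : pred I) (F : I -> V) x :
  vol (vcons (\sum_(i <- r | P i) F i) x) = \sum_(i <- r | P i) vol (vcons (F i) x).
Proof.
rewrite vol_vcons linear_sum mulmx_suml summxE.
by apply: eq_bigr => i _; rewrite vol_vcons.
Qed.

Lemma volN y x : vol (vcons (- y) x) = - vol (vcons y x).
Proof.
by rewrite !vol_vcons linearN mulNmx mxE.
Qed.

Lemma vol_nondegenerate w y :
  coords w = 1%:M -> (forall x, vol (vcons y x) = 0) -> phi y = 0.
Proof.
move=> w1 y0; apply/rowP => i.
have := vol_vcons_lift y w i; rewrite y0 w1 adj1 mulmx1 => /esym/eqP.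
by rewrite mulf_eq0 signr_eq0 mxE => /eqP.
Qed.

Lemma vol_rotate (f : 'I_N.+1 -> V) i :
  vol (vcons (f i) (fun l => f (lift i l))) = (-1) ^+ i * vol f.
Proof.
rewrite vol_vcons_lift; congr (_ * _).
have -> : phi (f i) = row i (coords f) by rewrite rowK.
by rewrite -row_mul mul_mx_adj !mxE eqxx.
Qed.

End Volume.

(** * The differential of a contracted volume form *)

Section Differential.
Variables (R : realType) (V : vectType R) (br : V -> V -> V).
Hypothesis br_anti : forall X Y, br Y X = - br X Y.

Section Trace.
Variables (N : nat) (phi : {linear V -> 'rV[R]_N.+1}).
Hypothesis unimodular : forall X,
  exists2 B : 'M[R]_N.+1, \tr B = 0 & forall Y, phi (br X Y) = phi Y *m B.

(** The left side is the derivative of vol at f along ad X.  With M = coords f it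
    equals \tr (M *m B *m \adj M) = \tr B * \det M. *)
Lemma vol_bracket_sum X (f : 'I_N.+1 -> V) :
  \sum_(i < N.+1)
    (-1) ^+ i * vol phi (vcons (br X (f i)) (fun l => f (lift i l))) = 0.
Proof.
have [B trB brE] := unimodular X.
transitivity (\tr (coords phi f *m B *m \adj (coords phi f))).
  apply: eq_bigr => i _.
  rewrite vol_vcons_lift mulrA -expr2 sqrr_sign mul1r brE.
  have -> : phi (f i) = row i (coords phi f) by rewrite rowK.
  by rewrite -!row_mul mxE.
by rewrite mxtrace_mulC mulmxA mul_adj_mx mul_scalar_mx linearZ /= trB mulr0.
Qed.

End Trace.

(** A pair (j, i) encodes the ordered pair of distinct indices (j, lift j i);
    this involution exchanges the two. *)
Definition swap_pair k (p : 'I_k.+2 * 'I_k.+1) : 'I_k.+2 * 'I_k.+1 :=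
  (lift p.1 p.2, odflt p.2 (unlift (lift p.1 p.2) p.1)).

Lemma lift_swap_pair k (p : 'I_k.+2 * 'I_k.+1) :
  lift (swap_pair p).1 (swap_pair p).2 = p.1.
Proof.
rewrite /swap_pair /=; case: unliftP => [i' //|] /eqP.
by rewrite (negbTE (neq_lift _ _)).
Qed.

Lemma swap_pairK k : involutive (@swap_pair k).
Proof.
move=> p; have E1 := lift_swap_pair p.
have E2 := lift_swap_pair (swap_pair p).
have E3 : (swap_pair (swap_pair p)).1 = p.1 by [].
rewrite [LHS]surjective_pairing [RHS]surjective_pairing E3; congr (_, _).
by apply: (@lift_inj _ p.1); rewrite -{1}E3 E2.
Qed.

Lemma swap_pair1 k (p : 'I_k.+2 * 'I_k.+1) : (swap_pair p).1 = lift p.1 p.2.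
Proof. by []. Qed.

Arguments swap_pair : simpl never.

Lemma swap_pair_val k (p : 'I_k.+2 * 'I_k.+1) :
  bump (bump p.1 p.2) (swap_pair p).2 = p.1 :> nat.
Proof. by rewrite -[RHS](congr1 val (lift_swap_pair p)). Qed.

Lemma lift_lift_swap_pair k (p : 'I_k.+2 * 'I_k.+1) l :
  lift (lift p.1 p.2) (lift (swap_pair p).2 l) = lift p.1 (lift p.2 l).
Proof.
apply: val_inj => /=; have := swap_pair_val p; rewrite /bump.
by case: (leqP p.1 p.2) => ? /=; lia.
Qed.

Section Codifferential.
Variables (k : nat) (phi : {linear V -> 'rV[R]_k.+3}).
Hypothesis unimodular : forall X,
  exists2 B : 'M[R]_k.+3, \tr B = 0 & forall Y, phi (br X Y) = phi Y *m B.
Local Notation vol := (vol phi).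

(** vol_bracket_sum for the family v, x: the derivation induced by ad X kills
    vol, so its action on x is minus its action on v. *)
Lemma vol_bracket1 X v (x : 'I_k.+2 -> V) :
  \sum_(i < k.+2) (-1) ^+ i *
    vol (vcons (br X (x i)) (vcons v (fun l => x (lift i l))))
  = vol (vcons (br X v) x).
Proof.
have /eqP := vol_bracket_sum unimodular X (vcons v x).
rewrite big_ord_recl expr0 mul1r vcons0 addr_eq0 -sumrN => /eqP E.
transitivity (vol (vcons (br X v) (fun l => vcons v x (lift ord0 l)))); last first.
  by apply/eq_vol/eq_vcons => l; rewrite vcons_lift0.
rewrite E; apply: eq_bigr => i _.
rewrite /= exprS mulN1r mulNr opprK vcons_lift0; congr (_ * _).
by apply/eq_vol/eq_vcons => l; rewrite vcons_lift.
Qed.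

(** The same for the family u, v, x. *)
Lemma vol_bracket2 X u v (x : 'I_k.+1 -> V) :
  \sum_(i < k.+1) (-1) ^+ i *
    vol (vcons (br X (x i)) (vcons u (vcons v (fun l => x (lift i l)))))
  = vol (vcons (br X v) (vcons u x)) - vol (vcons (br X u) (vcons v x)).
Proof.
have := vol_bracket1 X u (vcons v x).
rewrite big_ord_recl expr0 mul1r vcons0 => <-.
have -> : vol (vcons (br X v) (vcons u (fun l => vcons v x (lift ord0 l)))) =
          vol (vcons (br X v) (vcons u x)).
  by apply/eq_vol/eq_vcons/eq_vcons => l; rewrite vcons_lift0.
rewrite opprD addNKr -sumrN; apply: eq_bigr => i _.
rewrite /= exprS mulN1r mulNr opprK vcons_lift0; congr (_ * _).
by apply/eq_vol/eq_vcons/eq_vcons => l; rewrite vcons_lift.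
Qed.

(** The summand is symmetric under exchange of the two indices, so twice the left
    side is a sum over all ordered pairs (j, i).  For fixed j the sum over i is
    given by vol_bracket2 with X = x j, which leaves brackets of x j with u and
    v; the sum over j of these is given by vol_bracket1 with X = v and X = u. *)
Lemma ce_diff_vol u v (x : 'I_k.+2 -> V) :
  ce_diff br (fun y : 'I_k.+1 -> V => vol (vcons u (vcons v y))) x
  = - vol (vcons (br u v) x).
Proof.
pose G (p : 'I_k.+2 * 'I_k.+1) : R := (-1) ^+ (p.2 + p.1) *
  vol (vcons (br (x (lift p.1 p.2)) (x p.1))
     (vcons u (vcons v (fun l => x (lift p.1 (lift p.2 l)))))).
have Gswap p : G (swap_pair p) = G p.
  have E := swap_pair_val p; rewrite /G lift_swap_pair swap_pair1 /=.
  have -> : (-1) ^+ ((swap_pair p).2 + bump p.1 p.2) = - (-1) ^+ (p.2 + p.1) :> R.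
    have [->|->] : ((swap_pair p).2 + bump p.1 p.2 = (p.2 + p.1).+1 \/
        p.2 + p.1 = ((swap_pair p).2 + bump p.1 p.2).+1)%N.
    - by move: E; rewrite /bump; lia.
    - by rewrite exprS mulN1r.
    - by rewrite exprS mulN1r opprK.
  rewrite br_anti volN mulrNN; congr (_ * _).
  by apply/eq_vol/eq_vcons/eq_vcons/eq_vcons => l; rewrite lift_lift_swap_pair.
have swap_lt (p : 'I_k.+2 * 'I_k.+1) :
   ((swap_pair p).2 < (swap_pair p).1)%N = ~~ (p.2 < p.1)%N.
  have := swap_pair_val p; rewrite swap_pair1 /= /bump; lia.
have dE : ce_diff br (fun y : 'I_k.+1 -> V => vol (vcons u (vcons v y))) x =
          \sum_(p : 'I_k.+2 * 'I_k.+1 | (p.2 < p.1)%N) G p.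
  rewrite /= pair_big_dep /=; apply: eq_bigr => -[j i] _ /=.
  rewrite /G /=; congr (_ * _).
  (* The bracket moves past u and v, an even permutation. *)
  have := vol_rotate phi (vcons u (vcons v (vcons (br (x (lift j i)) (x j))
    (fun l => x (lift j (lift i l)))))) (lift ord0 (lift ord0 ord0)).
  rewrite /= sqrrN expr1n mul1r => <-; rewrite !vcons_lift0 vcons0.
  apply/eq_vol/eq_vcons => l; rewrite vcons_lift.
  apply: eq_vcons => {}l; rewrite vcons_lift.
  by apply: eq_vcons => {}l; rewrite vcons_lift0.
have sumG : \sum_p G p = - vol (vcons (br u v) x) *+ 2.
  rewrite -(pair_bigA _ (fun j i => G (j, i))) /= /G /=.
  transitivity (\sum_(j < k.+2) (-1) ^+ j *
      (vol (vcons (br v (x j)) (vcons u (fun l => x (lift j l))))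
     - vol (vcons (br u (x j)) (vcons v (fun l => x (lift j l)))))).
    apply: eq_bigr => j _.
    have := vol_bracket2 (x j) u v (fun l => x (lift j l)).
    rewrite (br_anti v (x j)) (br_anti u (x j)) !volN -opprD.
    move=> /(congr1 -%R); rewrite opprK => <-.
    rewrite -sumrN big_distrr /=; apply: eq_bigr => i _.
    by rewrite (br_anti (x j)) volN exprD [_ ^+ i * _]mulrC -!mulrA !mulrN.
  under eq_bigr do rewrite mulrBr.
  rewrite big_split /= sumrN !vol_bracket1 (br_anti u v) volN.
  by rewrite mulr2n.
move: sumG; rewrite (bigID (fun p : 'I_k.+2 * 'I_k.+1 => (p.2 < p.1)%N)) /=.
rewrite [X in _ + X](reindex_inj (inv_inj (@swap_pairK k))) /=.
rewrite (eq_bigl _ _ (fun p => congr1 negb (swap_lt p))) /=.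
under [X in _ + X]eq_bigl do rewrite negbK.
rewrite (eq_bigr _ (fun p _ => Gswap p)) -dE -mulr2n => /eqP.
by rewrite -subr_eq0 -mulrnBl mulrn_eq0 subr_eq0 => /eqP.
Qed.

End Codifferential.
End Differential.

(** * Powers of a 2-form in terms of determinants *)

Lemma det_mx22 (R : comNzRingType) (M : 'M[R]_2) :
  \det M = M ord0 ord0 * M ord_max ord_max - M ord0 ord_max * M ord_max ord0.
Proof.
rewrite (expand_det_row _ ord0) !big_ord_recl big_ord0 addr0 /cofactor !det_mx11.
rewrite !mxE /= expr0 expr1 mul1r mulN1r mulrN.
by congr (_ * M _ _ - M _ _ * M _ _); apply: val_inj.
Qed.

Lemma big_tuple_cons (R : nmodType) (I : finType) k (G : k.+1.-tuple I -> R) :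
  \sum_(a : k.+1.-tuple I) G a = \sum_(b : I) \sum_(a : k.-tuple I) G (cons_tuple b a).
Proof.
rewrite pair_bigA /= (reindex (fun p : I * k.-tuple I => cons_tuple p.1 p.2)) //=.
exists (fun t => (thead t, behead_tuple t)) => [[b a] _|t _] /=.
  by congr (_, _); apply: val_inj.
by case/tupleP: t => b a; apply: val_inj.
Qed.

Section WedgePower.
Variables (R : realType) (V : vectType R) (n : nat).
Variables (al be : 'I_n.+1 -> V -> R).

(** The covectors al_(a_0), be_(a_0), al_(a_1), be_(a_1), ... interleaved: this
    is the order in which iterated wedge products list them. *)
Definition pair_cov (a : seq 'I_n.+1) (j : nat) : V -> R :=
  (if odd j then be else al) (nth ord0 a j./2).

Definition pair_mx (a : seq 'I_n.+1) N (x : 'I_N -> V) : 'M[R]_N :=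
  \matrix_(i < N, j < N) pair_cov a j (x i).

Variable F : kform V 2.
(* F is the sum over b of the wedge products of al b and be b. *)
Hypothesis FE : forall x, F x =
  \sum_b (al b (x ord0) * be b (x ord_max) - be b (x ord0) * al b (x ord_max)).

(** By induction: for each b :: a, the first two columns and the remaining ones
    give the two minors of sum_sign_det_block. *)
Lemma wedge_pow_pair k :
  {c : R | 0 < c & forall x : 'I_(k * 2) -> V,
   @wedge_pow R V 2 F k x = c * \sum_(a : k.-tuple 'I_n.+1) \det (pair_mx a x)}.
Proof.
elim: k => [|k [c c_gt0 IH]].
  exists 1 => // x; rewrite mul1r (bigD1 [tuple]) //= big1 ?addr0.
    by rewrite det_mx00.
  by move=> a /eqP[]; apply: tuple0.
have [C C_gt0 block] := sum_sign_det_block R 2 (k * 2).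
exists ((2`! * (k * 2)`!)%:R^-1 * (c * C%:R)).
  by rewrite !mulr_gt0 ?invr_gt0 ?ltr0n ?muln_gt0 ?fact_gt0.
move=> x /=; rewrite /wedge -mulrA; congr (_ * _).
pose P b (a : k.-tuple 'I_n.+1) : 'M[R]_(2 + k * 2) := pair_mx (b :: a) x.
have F2 b (a : k.-tuple 'I_n.+1) (s : 'S_(2 + k * 2)) :
    \det (ulsubmx (row_perm s (P b a))) =
    al b (x (s (lshift _ ord0))) * be b (x (s (lshift _ ord_max)))
    - be b (x (s (lshift _ ord0))) * al b (x (s (lshift _ ord_max))).
  by rewrite det_mx22 !mxE.
have G2 b (a : k.-tuple 'I_n.+1) (s : 'S_(2 + k * 2)) :
    drsubmx (row_perm s (P b a)) =
    pair_mx a (fun j => x (s (rshift 2 j))).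
  by apply/matrixP => i j; rewrite !mxE /pair_cov /= negbK.
rewrite big_tuple_cons.
transitivity (\sum_(s : 'S_(2 + k * 2)) \sum_b \sum_(a : k.-tuple 'I_n.+1)
   c * ((-1) ^+ s * (\det (ulsubmx (row_perm s (P b a)))
                   * \det (drsubmx (row_perm s (P b a)))))).
  apply: eq_bigr => s _; rewrite FE IH.
  rewrite mulr_suml big_distrr /=; apply: eq_bigr => b _.
  rewrite !big_distrr /=; apply: eq_bigr => a _.
  by rewrite F2 G2 [in RHS]mulrCA; congr (_ * _); rewrite mulrCA.
rewrite -mulrA !big_distrr exchange_big /=; apply: eq_bigr => b _.
rewrite exchange_big !big_distrr /=; apply: eq_bigr => a _.
by rewrite -big_distrr block.
Qed.
End WedgePower.

(** * Permutations acting on pairs of indices *)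

Section Doubling.
Variable n : nat.
Implicit Types (j : 'I_(n.+1 * 2)) (i : 'I_n.+1).

(** Indices of 'I_(n.+1 * 2) are identified with pairs (half, parity), matching the
    interleaving of pair_cov. *)
Definition half_ord j : 'I_n.+1 := inord j./2.
Definition pair_ord i (b : bool) : 'I_(n.+1 * 2) := inord (b + i.*2)%N.

Lemma half_ordE j : half_ord j = j./2 :> nat.
Proof. by rewrite inordK // ltn_half_double -muln2. Qed.

Lemma pair_ordE i b : pair_ord i b = (b + i.*2)%N :> nat.
Proof.
have lt_n2 : (b + i.*2 < n.+1 * 2)%N.
  by rewrite muln2 -ltn_half_double half_bit_double.
by rewrite inordK.
Qed.

Lemma odd_pair_ord i b : odd (pair_ord i b) = b.
Proof. by rewrite pair_ordE oddD odd_double addbF oddb. Qed.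

Lemma half_pair_ord i b : half_ord (pair_ord i b) = i.
Proof. by apply: ord_inj; rewrite half_ordE pair_ordE half_bit_double. Qed.

Lemma pair_half_ord j : pair_ord (half_ord j) (odd j) = j.
Proof. by apply: ord_inj; rewrite pair_ordE half_ordE odd_double_half. Qed.

Definition double_fun (h : bool -> 'I_n.+1 -> 'I_n.+1) j :=
  pair_ord (h (odd j) (half_ord j)) (odd j).

Lemma double_fun_inj h : (forall b, injective (h b)) -> injective (double_fun h).
Proof.
move=> h_inj j k E; have := congr1 half_ord E; have := congr1 (odd \o val) E.
rewrite /double_fun /= !odd_pair_ord !half_pair_ord => Eo; rewrite Eo => /h_inj Eh.
by rewrite -[LHS]pair_half_ord -[RHS]pair_half_ord Eh Eo.
Qed.

Fact half_perm_subproof (p : bool) (s : 'S_n.+1) :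
  injective (double_fun (fun b i => if b == p then s i else i)).
Proof. by apply: double_fun_inj => b; case: (b == p) => // ? ? /perm_inj. Qed.

Definition half_perm (p : bool) (s : 'S_n.+1) : 'S_(n.+1 * 2) :=
  perm (@half_perm_subproof p s).

Fact parity_swap_subproof :
  involutive (fun j => pair_ord (half_ord j) (~~ odd j)).
Proof.
by move=> j; rewrite half_pair_ord odd_pair_ord negbK pair_half_ord.
Qed.

Definition parity_swap : 'S_(n.+1 * 2) := perm (inv_inj parity_swap_subproof).

(** Acting by s on the even or on the odd positions only are conjugate
    permutations, so their product double_perm s is even. *)
Lemma half_perm_conj s : half_perm true s = (half_perm false s ^ parity_swap)%g.
Proof.
apply/permP => j; have jK : parity_swap (parity_swap j) = j.
  by rewrite !permE parity_swap_subproof.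
rewrite -{2}jK permJ !permE /double_fun !half_pair_ord !odd_pair_ord.
by case: (odd j).
Qed.

Definition double_perm s := (half_perm false s * half_perm true s)%g.

Lemma double_permE s j :
  double_perm s j = pair_ord (s (half_ord j)) (odd j).
Proof.
rewrite permM !permE /double_fun !half_pair_ord !odd_pair_ord.
by case: (odd j).
Qed.

Lemma odd_double_perm s : odd_perm (double_perm s) = false.
Proof. by rewrite odd_permM half_perm_conj odd_permJ addbb. Qed.

End Doubling.

(** * The penultimate power as a contracted volume form *)

(** Exchanging two positions of b preserves uniqueness of its entries, so the sum
    is the same with any other entry in place of the first one; averaging over
    all positions, each b contributes the full sum of f. *)
Lemma sum_uniq_thead (R : numFieldType) n :
  {c : R | 0 < c & forall f : 'I_n.+1 -> R,
   \sum_(b : n.+1.-tuple 'I_n.+1 | uniq b) f (thead b) = c * \sum_k f k}.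
Proof.
pose swap (i : 'I_n.+1) (b : n.+1.-tuple 'I_n.+1) : n.+1.-tuple 'I_n.+1 :=
  [tuple tnth b (tperm ord0 i j) | j < n.+1].
have swapK i : involutive (swap i).
  by move=> b; apply: eq_from_tnth => j; rewrite !tnth_mktuple tpermK.
have uniq_swap (i : 'I_n.+1) (b : n.+1.-tuple 'I_n.+1) : uniq b -> uniq (swap i b).
  move=> /tuple_uniqP b_inj; apply/tuple_uniqP => j1 j2.
  by rewrite !tnth_mktuple => /b_inj/perm_inj.
have uniq_swapE (i : 'I_n.+1) (b : n.+1.-tuple 'I_n.+1) : uniq (swap i b) = uniq b.
  by apply/idP/idP => /(uniq_swap i); rewrite ?swapK.
pose U := (\sum_(b : n.+1.-tuple 'I_n.+1 | uniq b) 1)%N.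
exists (U%:R / n.+1%:R).
  rewrite divr_gt0 ?ltr0n // /U (bigD1 (ord_tuple n.+1)) //=.
  exact: enum_uniq.
move=> f; apply: (mulfI (_ : n.+1%:R != 0)); first by rewrite pnatr_eq0.
rewrite mulrA mulrCA divff ?pnatr_eq0 // mulr1.
transitivity (\sum_(i < n.+1) \sum_(b : n.+1.-tuple 'I_n.+1 | uniq b) f (tnth b i)).
  set S := \sum_(b | _) _; rewrite mulr_natl.
  have -> : S *+ n.+1 = \sum_(i < n.+1) S by rewrite sumr_const card_ord.
  apply: eq_bigr => i _; rewrite {}/S.
  rewrite [LHS](reindex_inj (inv_inj (swapK i))) /=; apply: eq_big => b.
    exact: uniq_swapE.
  by rewrite [thead _]tnth_mktuple tpermL.
rewrite exchange_big /= /U natr_sum mulr_suml; apply: eq_bigr => b uniq_b.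
have b_inj : injective (tnth b) by apply/tuple_uniqP.
by rewrite mul1r [RHS](reindex_inj b_inj).
Qed.

Section PairDeterminants.
Variables (R : realType) (V : vectType R) (n : nat).
Variables (al be : 'I_n.+1 -> V -> R).
Local Notation pmx := (pair_mx al be).

Lemma det_pair_mx_nonuniq k (a : k.-tuple 'I_n.+1) (x : 'I_(k * 2) -> V) :
  ~~ uniq a -> \det (pmx a x) = 0.
Proof.
case/(uniqPn ord0) => i [j] [lt_ij]; rewrite size_tuple => lt_jk eq_ij.
rewrite -det_tr.
have ub m : (m < k)%N -> (m.*2 < k * 2)%N by rewrite muln2 ltn_double.
apply: (determinant_alternate (i1 := Ordinal (ub i (ltn_trans lt_ij lt_jk)))
                              (i2 := Ordinal (ub j lt_jk))).
  by rewrite -(inj_eq val_inj) /= -!muln2 eqn_pmul2r // ltn_eqF.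
by move=> l; rewrite !mxE /pair_cov /= !odd_double !doubleK eq_ij.
Qed.

Lemma det_pair_mx_uniq (b : n.+1.-tuple 'I_n.+1) (f : 'I_(n.+1 * 2) -> V) :
  uniq b -> \det (pmx b f) = \det (pmx (ord_tuple n.+1) f).
Proof.
move=> uniq_b.
have b_inj : injective (tnth b) by apply/tuple_uniqP.
have -> : pmx b f = col_perm (double_perm (perm b_inj)) (pmx (ord_tuple n.+1) f).
  apply/matrixP => i j; rewrite !mxE /pair_cov double_permE odd_pair_ord permE.
  congr ((if _ then _ else _) _ _); rewrite -!half_ordE half_pair_ord -!tnth_nth.
  by rewrite tnth_ord_tuple.
by rewrite col_permE det_mulmx det_perm odd_permV odd_double_perm mulr1.
Qed.

Variables (u v : 'I_n.+1 -> V).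
Hypothesis al_u : forall i j, al i (u j) = (i == j)%:R.
Hypothesis al_v : forall i j, al i (v j) = 0.
Hypothesis be_u : forall i j, be i (u j) = 0.
Hypothesis be_v : forall i j, be i (v j) = (i == j)%:R.

(** Against the dual vectors u b, v b the first two rows are those of the identity
    matrix, so the determinant reduces to the lower right block. *)
Lemma det_pair_mx_cons k b (a : k.-tuple 'I_n.+1) (x : 'I_(k * 2) -> V) :
  b \notin a -> \det (pmx (b :: a) (vcons (u b) (vcons (v b) x))) = \det (pmx a x).
Proof.
move=> ba; set M := pmx _ _.
have row0 : lshift (k * 2) (ord0 : 'I_2) = ord0 by apply: val_inj.
have row1 : lshift (k * 2) (ord_max : 'I_2) = lift ord0 ord0 by apply: val_inj.
have row2 (j : 'I_(k * 2)) : rshift 2 j = lift ord0 (lift ord0 j).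
  exact: val_inj.
have nth_a (j : 'I_(k * 2)) : nth ord0 a j./2 == b = false.
  apply/negbTE; apply: contraNneq ba => <-.
  by rewrite mem_nth // size_tuple ltn_half_double -muln2.
have row0E : vcons (u b) (vcons (v b) x) (lshift (k * 2) (ord0 : 'I_2)) = u b.
  by rewrite row0 vcons0.
have row1E : vcons (u b) (vcons (v b) x) (lshift (k * 2) (ord_max : 'I_2)) = v b.
  by rewrite row1 vcons_lift0 vcons0.
have ord2 (i : 'I_2) : i = ord0 \/ i = ord_max.
  by case: i => [[|[|//]] i_lt]; [left|right]; apply: val_inj.
pose M' : 'M_(2 + k * 2) := M.
have ulM : ulsubmx M' = 1%:M.
  apply/matrixP => i j; rewrite !mxE.
  by case: (ord2 i) => ->; case: (ord2 j) => ->;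
     rewrite ?row0E ?row1E /pair_cov /= ?al_u ?al_v ?be_u ?be_v ?eqxx.
have urM : ursubmx M' = 0.
  apply/matrixP => i j; rewrite !mxE.
  by case: (ord2 i) => ->; rewrite ?row0E ?row1E /pair_cov /= negbK;
     case: odd; rewrite ?al_u ?al_v ?be_u ?be_v ?nth_a.
have drM : drsubmx M' = pmx a x.
  by apply/matrixP => i j; rewrite !mxE !row2 !vcons_lift0 /pair_cov /= negbK.
have -> : \det M = \det M' by [].
by rewrite -[M']submxK ulM urM drM det_lblock det1 mul1r.
Qed.

Variable F : kform V 2.
Hypothesis FE : forall x, F x =
  \sum_b (al b (x ord0) * be b (x ord_max) - be b (x ord0) * al b (x ord_max)).

(** A sequence a of n distinct indices misses exactly one index b, and b :: a is
    then an enumeration of all of them; the other sequences contribute 0. *)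
Lemma sum_det_pair_mx (x : 'I_(n * 2) -> V) :
  \sum_(a : n.-tuple 'I_n.+1) \det (pmx a x) =
  \sum_(b : n.+1.-tuple 'I_n.+1 | uniq b)
     \det (pmx (ord_tuple n.+1) (vcons (u (thead b)) (vcons (v (thead b)) x))).
Proof.
rewrite [RHS]big_mkcond [RHS]big_tuple_cons [RHS]exchange_big /=.
apply: eq_bigr => a _.
have [uniq_a|/det_pair_mx_nonuniq->] := boolP (uniq a); last first.
  by rewrite big1 // => b _; rewrite andbF.
have [b [ba bP]] : exists b, b \notin a /\ forall c, c \notin a -> c = b.
  have card1 : #|[predC a]| = 1%N.
    apply/eqP; rewrite -(eqn_add2l n) addn1; apply/eqP.
    by rewrite -[RHS](card_ord n.+1) -(cardC (mem a)) (card_uniqP uniq_a) size_tuple.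
  have [b bE] := mem_card1 card1; exists b; split=> [|c ca].
    by have := bE b; rewrite !inE eqxx.
  by apply/eqP; have := bE c; rewrite !inE ca.
rewrite (bigD1 b) //= ba big1 ?addr0 => [|c cb]; last first.
  by case: ifP => // /andP[/bP/eqP]; rewrite (negbTE cb).
rewrite theadE -(det_pair_mx_cons x ba) -[RHS](@det_pair_mx_uniq (cons_tuple b a)) //=.
by rewrite ba.
Qed.

Lemma wedge_pow_vol :
  {c : R | 0 < c & forall x : 'I_(n * 2) -> V, @wedge_pow R V 2 F n x =
    c * \sum_k \det (pmx (ord_tuple n.+1) (vcons (u k) (vcons (v k) x)))}.
Proof.
have [c1 c1_gt0 powE] := wedge_pow_pair FE n.
have [c2 c2_gt0 sumE] := sum_uniq_thead R n.
exists (c1 * c2); first exact: mulr_gt0.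
move=> x; rewrite powE sum_det_pair_mx -mulrA; congr (_ * _).
exact: (sumE (fun k => \det (pmx (ord_tuple n.+1) (vcons (u k) (vcons (v k) x))))).
Qed.

End PairDeterminants.

(** * Orthonormal bases *)

Section OrthonormalBases.
Variables (R : realType) (A : vectType R) (g : {dot A for idfun}).

Definition orthonormal_family n (e : n.-tuple A) :=
  forall i j : 'I_n, g e`_i e`_j = (i == j)%:R.

Lemma dotC x y : g x y = g y x.
Proof. by rewrite [LHS]hermC expr0 mul1r. Qed.

Lemma dot_family_coef n (e : n.-tuple A) k (i : 'I_n) :
  orthonormal_family e -> g (\sum_(j < n) k j *: e`_j) e`_i = k i.
Proof.
move=> e_on; rewrite linear_sumlz (bigD1 i) //= big1 => [|j /negbTE ji].
  by rewrite linearZl_LR /= e_on eqxx mulr1 addr0.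
by rewrite linearZl_LR /= e_on ji mulr0.
Qed.

Lemma orthonormal_family_free n (e : n.-tuple A) :
  orthonormal_family e -> free e.
Proof.
move=> e_on; apply/freeP => k sum0 i.
by rewrite -(dot_family_coef k i e_on) sum0 linear0l.
Qed.

Lemma orthonormal_family_expand n (e : n.-tuple A) :
  orthonormal_family e -> basis_of {:A} e ->
  forall x, x = \sum_(i < n) g x e`_i *: e`_i.
Proof.
move=> e_on e_basis x; have xe : x \in <<e>>%VS by rewrite (span_basis e_basis) memvf.
rewrite {1}(coord_span xe); apply: eq_bigr => i _; congr (_ *: _).
by rewrite {2}(coord_span xe) dot_family_coef.
Qed.

Lemma orthonormal_cons x (s : seq A) :
  orthonormal g (x :: s) = [&& g x x == 1, all (fun y => g x y == 0) s & orthonormal g s].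
Proof. by rewrite /orthonormal /= andbT -!andbA; do !bool_congr. Qed.

Lemma orthonormal_familyP n (e : n.-tuple A) :
  reflect (orthonormal_family e) (orthonormal g e).
Proof.
elim: n e => [|n IH] e; first by rewrite tuple0; constructor=> -[].
case/tupleP: e => x e; rewrite orthonormal_cons; apply: (iffP and3P).
  move=> [/eqP xx /allP xe /IH e_on] i j.
  have xe0 k : g x e`_(k : 'I_n) = 0 by apply/eqP/xe/mem_nth; rewrite size_tuple.
  case: (unliftP ord0 i) => [i'|] ->; case: (unliftP ord0 j) => [j'|] -> //=.
  - by rewrite e_on.
  - by rewrite dotC xe0.
  - by rewrite xe0.
move=> e_on; split.
- by rewrite (e_on ord0 ord0).
- apply/allP => y /(nthP 0) [k]; rewrite size_tuple => lt_kn <-.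
  by have /= -> := e_on ord0 (lift ord0 (Ordinal lt_kn)).
- by apply/IH => i j; have /= -> := e_on (lift ord0 i) (lift ord0 j).
Qed.

(** Gram-Schmidt, one vector at a time. *)
Lemma orthonormal_exists n :
  (n <= \dim {:A})%N -> exists e : n.-tuple A, orthonormal g e.
Proof.
elim: n => [|n IH] le_n; first by exists [tuple].
have [e e_on] := IH (ltnW le_n); have /orthonormal_familyP e_fam := e_on.
have : ~~ ({:A} <= <<e>>)%VS.
  apply: contraL le_n => /dimvS le_e; rewrite -leqNgt (leq_trans le_e) //.
  by rewrite (leq_trans (dim_span _)) // size_tuple.
case/subvPn => x _ xNe.
pose y := x - \sum_(i < n) g x e`_i *: e`_i.
have y0 : y != 0.
  apply: contraNneq xNe => /eqP; rewrite subr_eq0 => /eqP ->.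
  by apply: memv_suml => i _; rewrite memvZ // memv_span // mem_nth ?size_tuple.
have ye i : g y e`_(i : 'I_n) = 0.
  by rewrite linearBl /= dot_family_coef // subrr.
have yy : 0 < g y y by apply: neq0_dnorm_gt0.
exists (cons_tuple ((Num.sqrt (g y y))^-1 *: y) e).
rewrite orthonormal_cons e_on andbT; apply/andP; split.
  rewrite linearZl_LR /= linearZr_LR /= mulrA -invfM -expr2 sqr_sqrtr ?ltW //.
  by rewrite mulVf // gt_eqF.
apply/allP => z /(nthP 0) [k]; rewrite size_tuple => lt_kn <-.
by rewrite linearZl_LR /= (ye (Ordinal lt_kn)) mulr0.
Qed.

End OrthonormalBases.

(** * The Lie algebra aff(A) *)

Section AffBalanced.
Variables (R : realType) (A : vectType R) (n : nat).
Variables (mul : {bilinear A -> A -> A}) (g : {dot A for idfun}).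
Hypothesis mulC : commutative mul.
Hypothesis mul_nil : nilpotent_mul mul.
Variable e : n.+1.-tuple A.
Hypothesis e_on : orthonormal_family g e.
Hypothesis e_basis : basis_of {:A} e.

Local Notation V := (A * A)%type.
Local Notation br := (aff_bracket mul).

Definition hcoord (i : 'I_n.+1) (X : V) : R := g X.1 e`_i.
Definition vcoord (i : 'I_n.+1) (X : V) : R := g X.2 e`_i.
Definition hvec (i : 'I_n.+1) : V := (e`_i, 0).
Definition vvec (i : 'I_n.+1) : V := (0, e`_i).

Lemma hcoord_hvec i j : hcoord i (hvec j) = (i == j)%:R.
Proof. by rewrite /hcoord e_on eq_sym. Qed.
Lemma hcoord_vvec i j : hcoord i (vvec j) = 0.
Proof. by rewrite /hcoord linear0l. Qed.
Lemma vcoord_hvec i j : vcoord i (hvec j) = 0.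
Proof. by rewrite /vcoord linear0l. Qed.
Lemma vcoord_vvec i j : vcoord i (vvec j) = (i == j)%:R.
Proof. by rewrite /vcoord e_on eq_sym. Qed.

Lemma fundamental_formE (x : 'I_2 -> V) :
  fundamental_form (@aff_J R A) (dot_sum g) x =
  \sum_b (hcoord b (x ord0) * vcoord b (x ord_max)
        - vcoord b (x ord0) * hcoord b (x ord_max)).
Proof.
have parseval a c : g a c = \sum_(i < n.+1) g a e`_i * g c e`_i.
  rewrite {1}(orthonormal_family_expand e_on e_basis c) linear_sumr.
  by apply: eq_bigr => i _; rewrite linearZr_LR /= mulrC.
rewrite /fundamental_form /= /dot_sum /= !parseval -big_split /=.
by apply: eq_bigr => i _; rewrite linearNl mulrN.
Qed.

Definition aff_coord (X : V) : 'rV[R]_(n.+1 * 2) :=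
  \row_j pair_cov hcoord vcoord (ord_tuple n.+1) j X.

Fact aff_coord_is_linear : linear aff_coord.
Proof.
move=> a X Y; apply/rowP => j; rewrite !mxE /pair_cov.
by case: odd; rewrite /hcoord /vcoord linearPl.
Qed.

HB.instance Definition _ :=
  GRing.isLinear.Build R V 'rV[R]_(n.+1 * 2) *:%R aff_coord aff_coord_is_linear.

Definition aff_vec (j : 'I_(n.+1 * 2)) : V :=
  if odd j then vvec (half_ord j) else hvec (half_ord j).

Lemma aff_coordE X j :
  aff_coord X 0 j = if odd j then vcoord (half_ord j) X else hcoord (half_ord j) X.
Proof.
rewrite mxE /pair_cov -half_ordE -tnth_nth tnth_ord_tuple.
by case: odd.
Qed.

Lemma aff_coord_vec i : aff_coord (aff_vec i) = delta_mx 0 i.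
Proof.
apply/rowP => j; rewrite aff_coordE mxE /= /aff_vec.
have -> : (j == i) = (odd j == odd i) && (half_ord j == half_ord i).
  apply/eqP/andP => [->|[/eqP oE /eqP hE]]; first by rewrite !eqxx.
  by rewrite -[j]pair_half_ord -[i]pair_half_ord oE hE.
by case: (odd j); case: (odd i);
  rewrite /= ?hcoord_hvec ?hcoord_vvec ?vcoord_hvec ?vcoord_vvec.
Qed.

Lemma aff_coord_eq0 X : aff_coord X = 0 -> X = 0.
Proof.
move=> /rowP X0.
have h0 i : hcoord i X = 0.
  have := X0 (pair_ord i false).
  by rewrite aff_coordE odd_pair_ord half_pair_ord mxE.
have v0 i : vcoord i X = 0.
  have := X0 (pair_ord i true).
  by rewrite aff_coordE odd_pair_ord half_pair_ord mxE.
rewrite [X]surjective_pairing (orthonormal_family_expand e_on e_basis X.1).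
rewrite (orthonormal_family_expand e_on e_basis X.2).
congr (_, _); apply: big1 => i _.
  by rewrite -[g _ _]/(hcoord i X) h0 scale0r.
by rewrite -[g _ _]/(vcoord i X) v0 scale0r.
Qed.

Lemma aff_coord_expand X : X = \sum_j aff_coord X 0 j *: aff_vec j.
Proof.
apply/eqP; rewrite -subr_eq0; apply/eqP/aff_coord_eq0.
rewrite linearB linear_sum /= {1}[aff_coord X]row_sum_delta.
apply/eqP; rewrite subr_eq0; apply/eqP/eq_bigr => j _.
by rewrite linearZ /= aff_coord_vec.
Qed.

Lemma aff_bracket_anti X Y : br Y X = - br X Y.
Proof.
rewrite /aff_bracket; congr (_, _); rewrite /= ?oppr0 //.
by rewrite opprB (mulC Y.1) (mulC Y.2).
Qed.

Lemma aff_bracket_sumr X I (r : seq I) (c : I -> R) (Y : I -> V) :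
  br X (\sum_(i <- r) c i *: Y i) = \sum_(i <- r) c i *: br X (Y i).
Proof.
elim: r => [|i r IH]; first by rewrite !big_nil /aff_bracket /= !linear0r subr0.
rewrite !big_cons -IH /aff_bracket /=; congr (_, _); rewrite /= ?scaler0 ?addr0 //.
by rewrite !linearPr /= scalerBr opprD addrACA.
Qed.

(** Since (ad X)^(m+1) Y = (0, (X.1)^m * c) with c = X.1 * Y.2 - X.2 * Y.1, each
    ad X is nilpotent. *)
Lemma aff_unimodular X : exists2 B : 'M[R]_(n.+1 * 2), \tr B = 0 &
  forall Y, aff_coord (br X Y) = aff_coord Y *m B.
Proof.
pose B : 'M[R]_(n.+1 * 2) := \matrix_i aff_coord (br X (aff_vec i)).
have BE Y : aff_coord (br X Y) = aff_coord Y *m B.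
  rewrite {1}(aff_coord_expand Y) aff_bracket_sumr linear_sum /= mulmx_sum_row.
  by apply: eq_bigr => j _; rewrite linearZ /= rowK.
exists B => //.
have [k mul0] := mul_nil.
have iterB m Y : aff_coord (iter m (br X) Y) = aff_coord Y *m B ^+ m.
  elim: m => [|m IH]; first by rewrite mulmx1.
  by rewrite /= BE IH exprSr mulmxA.
have iter_mul m c : iter m (mul X.1) c = foldl mul c (nseq m X.1).
  by elim: m c => // m IH c; rewrite iterSr (mulC X.1) IH.
have iter_br m Y : iter m.+1 (br X) Y =
    (0, iter m (mul X.1) (mul X.1 Y.2 - mul X.2 Y.1)).
  elim: m => // m IH; rewrite iterS IH /aff_bracket /=.
  by rewrite linear0r subr0.
apply: (@mxtrace_nilpotent _ (n * 2).+1 B k.+1).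
apply/row_matrixP => i; rewrite rowE -aff_coord_vec -iterB row0 iter_br iter_mul.
by rewrite -[nseq _ _]/(val (nseq_tuple k X.1)) mul0 linear0.
Qed.


Lemma coords_aff_vec : coords aff_coord aff_vec = 1%:M.
Proof.
by apply/row_matrixP => i; rewrite rowK /= aff_coord_vec row1.
Qed.

Lemma det_pair_mx_vol f :
  \det (pair_mx hcoord vcoord (ord_tuple n.+1) f) = vol aff_coord f.
Proof. by congr (\det _); apply/matrixP => i j; rewrite !mxE. Qed.

Lemma aff_bracket_hv i : br (hvec i) (vvec i) = (0, mul e`_i e`_i).
Proof. by rewrite /aff_bracket /= linear0l subr0. Qed.

Lemma sum_aff_bracket_hv :
  \sum_i br (hvec i) (vvec i) = (0, \sum_(i < n.+1) mul e`_i e`_i).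
Proof.
under eq_bigr do rewrite aff_bracket_hv.
by elim/big_rec2: _ => // i X Y _ ->; congr (_, _); rewrite addr0.
Qed.

End AffBalanced.

Lemma ce_diff_scale_sum (R : realType) (V : vectType R) (br : V -> V -> V) k
    (a : kform V k.+1) (c : R) (I : finType) (G : I -> kform V k.+1) :
  (forall y, a y = c * \sum_i G i y) ->
  forall x, ce_diff br a x = c * \sum_i ce_diff br (G i) x.
Proof.
move=> aE x /=; rewrite exchange_big big_distrr /=; apply: eq_bigr => j _.
rewrite exchange_big big_distrr /=; apply: eq_bigr => i _.
by rewrite aE mulrCA -big_distrr.
Qed.

Section BalancedAff.
Variables (R : realType) (A : vectType R).
Variables (mul : {bilinear A -> A -> A}) (g : {dot A for idfun}).
Hypothesis mulC : commutative mul.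
Hypothesis mul_nil : nilpotent_mul mul.

Lemma ce_diff_fundamental_pow n (e : n.+2.-tuple A) :
  orthonormal_family g e -> basis_of {:A} e ->
  exists2 c : R, c != 0 & forall x,
  ce_diff (aff_bracket mul)
    (@wedge_pow R (A * A)%type 2 (fundamental_form (@aff_J R A) (dot_sum g)) n.+1) x
  = c * vol (aff_coord g e) (vcons (0, \sum_(i < n.+2) mul e`_i e`_i) x).
Proof.
move=> e_on e_basis.
have [c c_gt0 powE] := wedge_pow_vol (hcoord_hvec e_on) (hcoord_vvec g e)
  (vcoord_hvec g e) (vcoord_vvec e_on) (fundamental_formE e_on e_basis).
exists (- c); first by rewrite oppr_eq0 gt_eqF.
move=> x; rewrite (ce_diff_scale_sum _ powE) mulNr -mulrN; congr (_ * _).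
rewrite -sum_aff_bracket_hv vol_sum -sumrN; apply: eq_bigr => k _.
pose phi : {linear (A * A)%type -> 'rV[R]_(n.+2 * 2)} := aff_coord g e.
have := @ce_diff_vol R _ _ (aff_bracket_anti mulC) (n * 2).+1 phi
  (aff_unimodular mulC mul_nil e_on e_basis) (hvec e k) (vvec e k) x.
move=> <-; apply: eq_bigr => j _; apply: eq_bigr => i _; congr (_ * _).
exact: (det_pair_mx_vol g e).
Qed.


(** If mul a a = c *: a, then the product of k + 1 copies of a is c ^+ k *: a. *)
Lemma nilpotent_mul_line (a : A) (c : R) : mul a a = c *: a -> mul a a = 0.
Proof.
move=> aa; have [k mul0] := mul_nil.
have : foldl mul a (nseq_tuple k a) = c ^+ k *: a.
  suff E x : foldl mul (x *: a) (nseq_tuple k a) = (x * c ^+ k) *: a.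
    by rewrite -{1}[a]scale1r E mul1r.
  elim: (k) x => [|m IH] x; first by rewrite mulr1.
  by rewrite /= linearZl_LR /= aa scalerA IH exprS mulrA.
rewrite mul0 => /esym/eqP; rewrite scaler_eq0 expf_eq0 => /orP[/andP[_]|] /eqP E0.
  by rewrite aa E0 scale0r.
by rewrite E0 linear0l.
Qed.

Lemma balanced_aff_basis n (e : n.-tuple A) :
  orthonormal_family g e -> basis_of {:A} e ->
  balanced (aff_bracket mul) (@aff_J R A) (dot_sum g) <->
  \sum_(i < n) mul e`_i e`_i = 0.
Proof.
move=> e_on e_basis; rewrite /balanced.
have -> : (\dim {:(A * A)%type})./2 = n.
  have -> : \dim {:(A * A)%type} = (\dim {:A} + \dim {:A})%N by rewrite !dimvf.
  by rewrite -(size_basis e_basis) addnn doubleK.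
case: n e e_on e_basis => [|[|n]] e e_on e_basis.
- by split=> _ //; rewrite big_ord0.
- split=> _ //; rewrite big_ord_recl big_ord0 addr0 /=.
  apply: (nilpotent_mul_line (c := g (mul e`_0 e`_0) e`_0)).
  rewrite {1}(orthonormal_family_expand e_on e_basis (mul _ _)).
  by rewrite big_ord_recl big_ord0 addr0.
have [c c0 dE] := ce_diff_fundamental_pow e_on e_basis.
split=> [bal|sum0 x]; last first.
  by rewrite [LHS]dE sum0 vol_vcons linear0 mul0mx mxE mulr0.
have : ((0, \sum_(i < n.+2) mul e`_i e`_i) : A * A) = 0.
  apply: (aff_coord_eq0 e_on e_basis).
  apply: (vol_nondegenerate (coords_aff_vec e_on)) => x.
  by have /eqP := bal x; rewrite [X in X == _]dE mulf_eq0 (negbTE c0) => /eqP.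
by case.
Qed.

End BalancedAff.

Theorem proposition5p1 (R : realType) (n : nat) (A : vectType R)
    (dimA : \dim {:A} = n)
    (mul : {bilinear A -> A -> A})
    (mulC : commutative mul) (mulA : associative mul)
    (mul_nil : nilpotent_mul mul)
    (g : {dot A for idfun}) :
  balanced (aff_bracket mul) (@aff_J R A) (dot_sum g) <->
  exists e : n.-tuple A,
    [/\ basis_of {:A} e, orthonormal g e & \sum_(i < n) mul e`_i e`_i = 0].
Proof.
split=> [bal|[e [e_basis /orthonormal_familyP e_on sum0]]]; last first.
  exact/(balanced_aff_basis mulC mul_nil e_on e_basis).
have [|e e_orth] := @orthonormal_exists R A g n; first by rewrite dimA.
have /orthonormal_familyP e_on := e_orth.
have e_basis : basis_of {:A} e.
  by rewrite basisEfree (orthonormal_family_free e_on) subvf size_tuple dimA /=.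
by exists e; split=> //; apply/(balanced_aff_basis mulC mul_nil e_on e_basis).
Qed.
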